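(* There exist a constant $c>0$ and an integer $d_0$ such that for all integers $d\ge d_0$, $$N_d\ >\ d+\exp\!\left(c\sqrt{\ln d}\right).$$
   Context: Let $\mathcal{S}_n$ be the set of all permutations of $\{1,\ldots,n\}$, written as sequences $\mathbf{x}=x_1\ldots x_n$. For $1\le k\le n$, a $k$-minor of $\mathbf{x}\in\mathcal{S}_n$ is a subsequence of $\mathbf{x}$ of length $k$ (entries taken in increasing index positions) whose entries are renumbered by $1,2,\ldots,k$ preserving their relative order. The $k$-deck $D_k(\mathbf{x})$ is the multiset of all $\binom{n}{k}$ $k$-minors of $\mathbf{x}$ (one for each choice of $k$ index positions). For a positive integer $d$, $N_d$ denotes the smallest integer $N>d$ such that for every $n\ge N$, every permutation of length $n$ can be reconstructed from its $(n-d)$-deck, i.e. $D_{n-d}(\mathbf{x})\neq D_{n-d}(\mathbf{y})$ for all distinct $\mathbf{x},\mathbf{y}\in\mathcal{S}_n$. (It is known that $N_d$ exists for every $d$.) Here $\ln$ is the natural logarithm. *)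

(* Defs.v *)
From HB Require Import structures.
From mathcomp Require Import all_boot all_order all_fingroup all_algebra.
From mathcomp Require Import finmap multiset.

Set Implicit Arguments.
Unset Strict Implicit.
Unset Printing Implicit Defensive.

Local Open Scope mset_scope.

(* Renumbers pairwise distinct entries by 1, 2, ..., size s: each entry is    *)
(* replaced by its rank among the entries of s.                               *)
Definition renumber (s : seq nat) : seq nat :=
  [seq count (fun b => b <= a) s | a <- s].

(* A permutation of {1, ..., n} is encoded as x : 'S_n, with positions and    *)
(* values shifted to {0, ..., n - 1}; the shift does not affect minors. The   *)
(* sequence enum A lists the positions in A increasingly.                     *)
Definition minor (n : nat) (x : 'S_n) (A : {set 'I_n}) : seq nat :=
  renumber [seq nat_of_ord (x i) | i <- enum A].

Definition deck (k n : nat) (x : 'S_n) : {mset (seq nat)} :=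
  seq_mset [seq minor x A | A <- enum [set A : {set 'I_n} | #|A| == k]].

Definition deck_reconstructible (n k : nat) : Prop :=
  forall x y : 'S_n, x <> y -> deck k x <> deck k y.

Definition reconstruction_bound (d N : nat) : Prop :=
  d < N /\ forall n : nat, N <= n -> deck_reconstructible n (n - d).

(* "N = N_d". Such an N is unique; its existence for every d > 0 is known.     *)
Definition is_N (d N : nat) : Prop :=
  reconstruction_bound d N /\
  forall M : nat, reconstruction_bound d M -> N <= M.

(* Main.v *)
Require Import Defs.
From HB Require Import structures.
From mathcomp Require Import all_boot all_order all_fingroup all_algebra.
From mathcomp Require Import reals sequences exp.
From mathcomp Require Import multiset zify lra.
Import Order.TTheory GRing.Theory Num.Theory.
Local Open Scope ring_scope.

(** The bound follows from pairs of distinct permutations of a length n that is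
at most exp(C ln^2 k) plus k, whose k-decks coincide. They come from binary
words. Number the letters of a word u of length n by first listing the zeros
from left to right and then the ones. This gives a permutation, and its minor at
a set A of positions is obtained in the same way from the subword of u at A
(minor_pattern). Hence words with the same multiset of subwords of length k give
permutations with the same k-deck, and a trailing zero makes the word readable
from the permutation (equal_decks).

Words of length 2^(2t(t+1)) with the same subwords of every length below 2^t are
built by induction on t (agreeing_words). Occurrences of a subword w in u are
counted by a corner entry of the product, over the letters c of u, of unipotent
matrices 1 + N_c (count_subwords), and two words have the same subwords of
length below J exactly when the differences of these products vanish below the
J-th superdiagonal. Suppose that p and q, with matrices P and P + D, are such
words. Substitute them for the letters 0 and 1 of a word u. Up to products with
two factors D, which vanish below superdiagonal 2J, the result depends on u only
through its length m and the sum of P^i D P^(m-1-i) over the positions i of its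
ones. Expanding P = x + 1 by the binomial theorem, that sum depends, to the same
order, only on the J^2 numbers sum_i C(i,r) C(m-1-i,s) with r, s < J
(agree_subst). These moments are at most polynomial in m of degree 2J, so by
pigeonhole two distinct words of length m = 2^(4t+4) share all of them when
J = 2^t (equal_moments). Thus one substitution doubles J and multiplies the
length by a fixed power of 2J.

Given d, take t maximal with 2^(2t(t+1)) <= d and k = 2^t - 1. The words, padded
to length d + k, show that N_d > d + k, and k >= exp(c sqrt(ln d)) for
c = (ln 2)/8. *)

Set Implicit Arguments.
Unset Strict Implicit.
Unset Printing Implicit Defensive.

(** * The filtration of matrices by superdiagonals *)

(** All entries strictly below the d-th superdiagonal vanish; d = 0 means upper
triangular. These sets form a multiplicative filtration, the matrix counterpart
of noncommutative power series without terms of degree less than d. *)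
Definition above (m d : nat) (M : 'M[int]_m.+1) : Prop :=
  forall a b : 'I_m.+1, (b < a + d)%N -> M a b = 0.

Lemma above0 m d : above d (0 : 'M[int]_m.+1).
Proof. by move=> a b _; rewrite mxE. Qed.

Lemma aboveD m d (M N : 'M[int]_m.+1) : above d M -> above d N -> above d (M + N).
Proof. by move=> hM hN a b h; rewrite mxE hM // hN // addr0. Qed.

Lemma aboveN m d (M : 'M[int]_m.+1) : above d M -> above d (- M).
Proof. by move=> hM a b h; rewrite mxE hM // oppr0. Qed.

Lemma aboveB m d (M N : 'M[int]_m.+1) : above d M -> above d N -> above d (M - N).
Proof. by move=> hM /aboveN; apply: aboveD. Qed.

Lemma above_sum m d (I : Type) (r : seq I) (P : pred I) (F : I -> 'M[int]_m.+1) :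
  (forall i, P i -> above d (F i)) -> above d (\sum_(i <- r | P i) F i).
Proof.
by move=> hF; apply: big_ind => //; [apply: above0 | apply: aboveD].
Qed.

Lemma aboveMn m d (M : 'M[int]_m.+1) k : above d M -> above d (M *+ k).
Proof.
by elim: k => [|k IH] hM; [rewrite mulr0n; apply: above0 | rewrite mulrS; apply: aboveD; auto].
Qed.

Lemma above_le m d e (M : 'M[int]_m.+1) : (d <= e)%N -> above e M -> above d M.
Proof. by move=> hde hM a b h; apply: hM; lia. Qed.

Lemma aboveM m d e (M N : 'M[int]_m.+1) : above d M -> above e N -> above (d + e) (M * N).
Proof.
move=> hM hN a b h; rewrite mxE big1 // => c _.
have [hc|hc] := ltnP c (a + d); first by rewrite hM ?mul0r.
by rewrite hN ?mulr0 //; lia.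
Qed.

Lemma above1 m : above 0 (1 : 'M[int]_m.+1).
Proof.
move=> a b h; rewrite mxE; case: eqP => // hab.
by move: h; rewrite hab addn0 ltnn.
Qed.

Lemma aboveX m d (M : 'M[int]_m.+1) k : above d M -> above (k * d) (M ^+ k).
Proof.
move=> hM; elim: k => [|k IH]; first by rewrite expr0; apply: above1.
by rewrite exprS mulSn; apply: aboveM.
Qed.

(** * Products of two nearly equal matrices *)

(** The part of degree one in D of the product over b in u of P + b D. *)
Definition first_order m (P D : 'M[int]_m.+1) (u : seq bool) : 'M[int]_m.+1 :=
  \sum_(i < size u) (P ^+ i * D * P ^+ (size u - i.+1)) *+ nth false u i.

(** Every further term of the expanded product contains D at least twice. *)
Lemma mixed_product_first_order m J (P D : 'M[int]_m.+1) (u : seq bool) :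
  above 0 P -> above J D ->
  above (J + J)
    (\prod_(b <- u) (if b then P + D else P) - P ^+ size u - first_order P D u).
Proof.
move=> hP hD.
have first_orderS b s :
    first_order P D (b :: s) = (D * P ^+ size s) *+ b + P * first_order P D s.
  rewrite /first_order big_ord_recl /= expr0 mul1r subn1 /=; congr (_ + _).
  rewrite mulr_sumr; apply: eq_bigr => i _.
  by rewrite /bump /= add1n subSS exprS -!mulrA mulrnAr.
have hX k : above 0 (P ^+ k) by have := @aboveX _ _ _ k hP; rewrite muln0.
(* The induction also needs that the zeroth order is exact up to degree J. *)
suff: above J (\prod_(b <- u) (if b then P + D else P) - P ^+ size u) /\
  above (J + J)
    (\prod_(b <- u) (if b then P + D else P) - P ^+ size u - first_order P D u) by case.
elim: u => [|b u [IH1 IH2]].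
  rewrite big_nil expr0 subrr /first_order big_ord0 subr0.
  by split; apply: above0.
rewrite big_cons first_orderS /= exprS.
set W := \prod_(b <- u) _ in IH1 IH2 *; set X := P ^+ size u in IH1 IH2 *.
set T := first_order P D u in IH1 IH2 *.
have hPW : above J (P * (W - X)) by have := aboveM hP IH1; rewrite add0n.
have hDX : above J (D * X) by rewrite -[J]addn0; apply: aboveM => //; apply: hX.
have hDW : above (J + J) (D * (W - X)) by apply: aboveM.
have hPT : above (J + J) (P * (W - X - T)).
  by have := aboveM hP IH2; rewrite add0n.
case: b.
- have E1 : (P + D) * W - P * X = P * (W - X) + (D * X + D * (W - X)).
    by rewrite !mulrBr mulrDl [D * X + _]addrC subrK addrAC.
  split; last first.
    have -> : (P + D) * W - P * X - ((D * X) *+ true + P * T)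
        = P * (W - X - T) + D * (W - X).
      rewrite mulr1n !mulrBr mulrDl opprD !addrA.
      by rewrite [LHS](ACl (1*3*5*2*4)).
    exact: aboveD.
  rewrite E1; apply: aboveD => //; apply: aboveD => //.
  by apply: above_le hDW; apply: leq_addr.
- rewrite mulr0n add0r -!mulrBr; split=> //.
Qed.

(** The binomial expansion of (x + 1)^i cut at degree J. *)
Definition truncated_power m (J : nat) (x : 'M[int]_m.+1) (i : nat) :=
  \sum_(r < J) x ^+ r *+ 'C(i, r).

Lemma above_truncated_power m J (x : 'M[int]_m.+1) i :
  above 1 x -> above J ((x + 1) ^+ i - truncated_power J x i).
Proof.
move=> hx; rewrite exprD1n /truncated_power.
(* Both sums are compared inside the longer range r < J + i + 1, where the
   binomial coefficients with r > i are zero. *)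
pose F r := x ^+ r *+ 'C(i, r).
have -> : \sum_(r < i.+1) x ^+ r *+ 'C(i, r) = \sum_(0 <= r < (J + i.+1)%N) F r.
  rewrite addnC (big_cat_nat _ (n := i.+1)) ?leq_addr //= big_mkord.
  rewrite [X in _ + X]big_nat_cond [X in _ + X]big1 ?addr0 // => r.
  by rewrite andbT => /andP[h _]; rewrite /F bin_small ?mulr0n.
rewrite (big_cat_nat _ (n := J)) ?leq_addr //= big_mkord addrAC subrr add0r.
rewrite big_nat_cond; apply: above_sum => r; rewrite andbT => /andP[h _].
apply: aboveMn; apply: (@above_le _ _ (r * 1)%N); first by rewrite muln1.
exact: aboveX.
Qed.

(** The sum over the positions i of the letter 1, with i letters before it and
[size u - i.+1] letters after it. It counts the ways to mark a one together with
r letters before it and s letters after it. *)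
Definition moment (u : seq bool) (r s : nat) : nat :=
  (\sum_(i < size u) nth false u i * ('C(i, r) * 'C(size u - i.+1, s)))%N.

(** Between two binomial expansions, D contributes degree J, so terms of degree at
least J in either power of x + 1 are negligible. *)
Lemma first_order_moments m J (x D : 'M[int]_m.+1) (u : seq bool) :
  above 1 x -> above J D ->
  above (J + J) (first_order (x + 1) D u
    - \sum_(r < J) \sum_(s < J) (x ^+ r * D * x ^+ s) *+ moment u r s).
Proof.
move=> hx hD.
pose B i := truncated_power J x i.
have -> : \sum_(r < J) \sum_(s < J) (x ^+ r * D * x ^+ s) *+ moment u r s
    = \sum_(i < size u) (B i * D * B (size u - i.+1)%N) *+ nth false u i.
  under eq_bigr => r _ do under eq_bigr => s _ do rewrite -sumrMnr.
  under eq_bigr => r _ do rewrite exchange_big /=.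
  rewrite exchange_big /=; apply: eq_bigr => i _.
  rewrite /B /truncated_power !mulr_suml -sumrMnl; apply: eq_bigr => r _.
  rewrite mulr_sumr -sumrMnl; apply: eq_bigr => s _.
  by rewrite !mulrnAl mulrnAr -!mulrnA; congr (_ *+ _); lia.
rewrite /first_order -sumrB; apply: above_sum => i _; rewrite -mulrnBl.
have hx1 : above 0 (x + 1).
  by apply: aboveD; [apply: above_le hx | apply: above1].
have hX k : above 0 ((x + 1) ^+ k) by have := @aboveX _ _ _ k hx1; rewrite muln0.
have hB k : above 0 (B k).
  apply: above_sum => r _; apply: aboveMn.
  by apply: above_le (@aboveX _ _ _ r hx).
have hXB k : above J ((x + 1) ^+ k - B k) by apply: above_truncated_power.
apply: aboveMn; set e := (size u - i.+1)%N.
have -> : (x + 1) ^+ i * D * (x + 1) ^+ e - B i * D * B e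
  = ((x + 1) ^+ i - B i) * D * (x + 1) ^+ e + B i * D * ((x + 1) ^+ e - B e).
  by rewrite !mulrBl !mulrBr addrA subrK.
apply: aboveD.
- by rewrite -[(J + J)%N]addn0; apply: aboveM => //; apply: aboveM.
- by apply: aboveM => //; rewrite -[J]add0n; apply: aboveM.
Qed.

(** * Words with the same short subwords *)

(** Nonzero only at the entries (a, a+1) such that the letter of w at a is c. The
default c of nth is immaterial, since a = size w has no entry a+1. *)
Definition letter_mx (w : seq bool) (c : bool) : 'M[int]_((size w).+1) :=
  \matrix_(a, b) (((b : nat) == a.+1) && (nth c w a == c))%:R.

(** Entry (a, b) is the number of occurrences, as a subword of u, of the factor of
w between the positions a and b. *)
Definition word_mx (w u : seq bool) : 'M[int]_((size w).+1) :=
  \prod_(c <- u) (1 + letter_mx w c).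

(** The words u and v have equally many occurrences of every subword of length
less than J, because entry (a, b) counts a factor of length b - a. *)
Definition agree_below (J : nat) (u v : seq bool) : Prop :=
  forall w, above J (word_mx w v - word_mx w u).

Lemma above_letter w c : above 1 (letter_mx w c).
Proof. by move=> a b h; rewrite mxE; case: eqP => // hb; lia. Qed.

Lemma above_word w u : above 1 (word_mx w u - 1).
Proof.
elim: u => [|c u IH]; first by rewrite /word_mx big_nil subrr; apply: above0.
have -> : word_mx w (c :: u) - 1
    = (word_mx w u - 1) + (letter_mx w c + letter_mx w c * (word_mx w u - 1)).
  by rewrite /word_mx big_cons mulrDl mul1r mulrBr mulr1 [letter_mx w c + _]addrC subrK addrAC.
apply: aboveD => //; apply: aboveD; first exact: above_letter.
by apply: above_le (aboveM (@above_letter w c) IH).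
Qed.

Lemma word_mx_cat w u v : word_mx w (u ++ v) = word_mx w u * word_mx w v.
Proof. by rewrite /word_mx big_cat. Qed.

Lemma agree_cat J u v s :
  agree_below J u v -> agree_below J (u ++ s) (v ++ s).
Proof.
move=> huv w; rewrite !word_mx_cat -mulrBl -[J]addn0; apply: aboveM => //.
rewrite -[word_mx w s](subrK 1); apply: aboveD; last exact: above1.
by apply: above_le (@above_word w s).
Qed.

Definition subst (p q u : seq bool) : seq bool :=
  flatten [seq if b then q else p | b : bool <- u].

Lemma size_subst p q u : size p = size q -> size (subst p q u) = (size u * size p)%N.
Proof.
move=> hpq; elim: u => //= b u IH.
by rewrite size_cat -/(subst p q u) IH mulSn; case: b; rewrite ?hpq.
Qed.

(** The blocks all have the same length, so the decomposition into blocks can be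
read off from the result. *)
Lemma subst_inj p q : size p = size q -> p <> q -> injective (subst p q).
Proof.
move=> hpq npq u v; have [p0|p0] := eqVneq p [::].
  by case: npq; rewrite p0; apply/esym/size0nil; rewrite -hpq p0.
move=> huv; have huv2 := congr1 size huv.
move: huv2; rewrite !size_subst // => /eqP; rewrite eqn_pmul2r ?lt0n ?size_eq0 //.
move/eqP => suv.
have : [seq if b then q else p | b : bool <- u] = [seq if b then q else p | b : bool <- v].
  apply: eq_from_flatten_shape huv _; rewrite /shape -!map_comp.
  have E (s : seq bool) : [seq (size \o (fun b : bool => if b then q else p)) i | i <- s]
      = nseq (size s) (size p) by elim: s => //= -[] s ->; rewrite ?hpq.
  by rewrite !E suv.
by apply: inj_map => -[] [] // /esym.
Qed.

(** The doubling step: with P and P + D the matrices of p and q, the matrix of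
[subst p q t] is known to degree 2J from the length and the moments of t. *)
Lemma agree_subst J p q u v :
  agree_below J p q -> size u = size v ->
  (forall r s, (r < J)%N -> (s < J)%N -> moment u r s = moment v r s) ->
  agree_below (J + J) (subst p q u) (subst p q v).
Proof.
move=> hpq suv hm w.
set P := word_mx w p; set D := word_mx w q - P.
have hD : above J D by apply: hpq.
have hx : above 1 (P - 1) by apply: above_word.
have hP : above 0 P.
  by rewrite -[P](subrK 1); apply: aboveD; [apply: above_le hx | apply: above1].
pose S t := \sum_(r < J) \sum_(s < J) ((P - 1) ^+ r * D * (P - 1) ^+ s) *+ moment t r s.
have main t : above (J + J) (word_mx w (subst p q t) - P ^+ size t - S t).
  have -> : word_mx w (subst p q t) = \prod_(b <- t) (if b then P + D else P).
    rewrite /word_mx big_flatten big_map; apply: eq_bigr => -[] _ //.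
    by rewrite /D addrC subrK.
  have h1 := mixed_product_first_order t hP hD.
  have := first_order_moments t hx hD; rewrite subrK => h2.
  by have := aboveD h1 h2; congr above; rewrite -/(S t) addrA subrK.
have := aboveB (main v) (main u); congr above.
have -> : S v = S u.
  apply: eq_bigr => r _; apply: eq_bigr => s _; by rewrite hm.
by rewrite suv opprB addrA subrK opprB addrA subrK.
Qed.

(** * Distinct words with equal moments *)

Lemma pigeonhole (T U : finType) (f : T -> U) :
  (#|U| < #|T|)%N -> exists x y, x <> y /\ f x = f y.
Proof.
move=> hlt; have /injectivePn [x [y /eqP nxy fxy]] : ~~ injectiveb f.
  by apply/injectiveP => /leq_card; rewrite leqNgt hlt.
by exists x, y.
Qed.

Lemma bin_leX n r J : (0 < n -> r < J.+1 -> 'C(n, r) <= n ^ J)%N.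
Proof.
move=> n0 hr; have h : ('C(n, r) <= n ^ r)%N.
  elim: n r {n0 hr} => [|n IH] [|r] //.
  have le_expS : (n ^ r <= n.+1 ^ r)%N by case: r => // r; rewrite leq_exp2r.
  rewrite binS expnS mulSn addnC; apply: leq_add.
    exact: leq_trans (IH r) le_expS.
  by apply: leq_trans (IH r.+1) _; rewrite expnS leq_mul2l le_expS orbT.
by apply: leq_trans h _; rewrite leq_pexp2l.
Qed.

Lemma moment_lt u r s J : (1 < size u)%N -> (r < J.+1)%N -> (s < J.+1)%N ->
  (moment u r s < size u ^ (2 * J.+1))%N.
Proof.
move=> u1 hr hs; set n := size u.
have n0 : (0 < n)%N by apply: ltnW.
have hC i t : (t < J.+1)%N -> (i <= n)%N -> ('C(i, t) <= n ^ J)%N.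
  move=> ht hi; apply: leq_trans (bin_leX n0 ht); exact: leq_bin2l.
apply: (@leq_ltn_trans (n * (n ^ J * n ^ J))).
  rewrite /moment -/n -[X in (_ <= X * _)%N]card_ord -sum_nat_const.
  apply: leq_sum => i _; rewrite -[X in (_ <= X)%N]mul1n.
  by apply: leq_mul; [case: nth | apply: leq_mul; apply: hC => //; [apply: ltnW | apply: leq_subr]].
rewrite -expnD -expnS ltn_exp2l //; lia.
Qed.

(** There are 2^n words of length n = 2^(4t+4), and at most n^(2 J^3) vectors of
J^2 moments, each smaller than n^(2J). The exponent of the latter power of two
is 8 (t+1) J^3, less than n = 16 J^4 because t + 1 < 2^(t+1). *)
Lemma equal_moments t (J := (2 ^ t)%N) : exists u v : seq bool,
  [/\ size u = (2 ^ (4 * t.+1))%N, size v = (2 ^ (4 * t.+1))%N, u <> v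
    & forall r s, (r < J)%N -> (s < J)%N -> moment u r s = moment v r s].
Proof.
set a := (4 * t.+1)%N; set n := (2 ^ a)%N.
pose B := (n ^ (2 * J)).-1.
have hB : B.+1 = (n ^ (2 * J))%N by rewrite /B prednK // !expn_gt0.
have hlt (u : n.-tuple bool) (r s : 'I_J) : (moment u r s <= B)%N.
  rewrite -ltnS hB; have J0 : J = J.-1.+1 by rewrite prednK // expn_gt0.
  have := @moment_lt u r s J.-1; rewrite -J0 size_tuple; apply=> //.
  by rewrite /n /a -[1%N]/(2 ^ 0)%N ltn_exp2l.
pose f (u : n.-tuple bool) := [ffun rs : 'I_J * 'I_J => inord (moment u rs.1 rs.2) : 'I_B.+1].
have [|u [v [nuv fuv]]] := @pigeonhole _ _ f.
  rewrite card_ffun card_tuple card_bool card_prod !card_ord hB -!expnM ltn_exp2l //.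
  have h1 : (t.+1 < 2 ^ t.+1)%N by apply: ltn_expl.
  have -> : n = (2 ^ t * 2 ^ t * 2 ^ t * 8 * 2 ^ t.+1)%N.
    by rewrite /n /a -[8%N]/(2 ^ 3)%N -!expnD; congr (_ ^ _)%N; lia.
  rewrite -/J /a; have : (0 < J * J * J)%N by rewrite !muln_gt0 !expn_gt0.
  nia.
exists u, v; rewrite !size_tuple; split=> // [/val_inj //|r s hr hs].
move/ffunP: fuv => /(_ (Ordinal hr, Ordinal hs)) /(congr1 val).
by rewrite !ffunE /= !inordK // ltnS (hlt _ (Ordinal hr) (Ordinal hs)).
Qed.

(** Start from the two one-letter words, which have the same empty subword. The
exponents add up because 2t(t+1) + 4(t+1) = 2(t+1)(t+2). *)
Lemma agreeing_words t : exists p q : seq bool,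
  [/\ size p = (2 ^ (2 * t * t.+1))%N, size q = (2 ^ (2 * t * t.+1))%N, p <> q
    & agree_below (2 ^ t) p q].
Proof.
elim: t => [|t [p [q [sp sq npq hpq]]]].
  exists [:: false], [:: true]; split=> // w.
  rewrite -[word_mx w _](subrK 1) -addrA; apply: aboveD; first exact: above_word.
  by rewrite -opprB; apply: aboveN; apply: above_word.
have [u [v [su sv nuv hm]]] := equal_moments t.
exists (subst p q u), (subst p q v).
have spq : size p = size q by rewrite sp.
have hexp : (2 ^ (4 * t.+1) * 2 ^ (2 * t * t.+1) = 2 ^ (2 * t.+1 * t.+2))%N.
  by rewrite -expnD; congr (_ ^ _)%N; lia.
split; rewrite ?size_subst ?su ?sv ?sp //.
- by move/(subst_inj spq npq).
- by rewrite expnS mul2n -addnn; apply: agree_subst; rewrite ?su.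
Qed.

(** * Matrix entries count subwords *)

Definition subword n (u : seq bool) (A : {set 'I_n}) : seq bool :=
  [seq nth false u i | i : 'I_n <- enum A].

(** Reading v moves from a along the letters of w, as in a deterministic automaton
that fails at the first mismatch. *)
Lemma prod_letters w v (a b : 'I_(size w).+1) :
  (\prod_(c <- v) letter_mx w c) a b
    = (((b : nat) == a + size v)%N && (take (size v) (drop a w) == v))%:R.
Proof.
elim: v a => [|c v IH] a.
  rewrite big_nil -[1]/(1%:M) mxE take0 andbT addn0; congr (_%:R); congr nat_of_bool.
  by rewrite eq_sym.
rewrite big_cons mxE /=.
have [ha|ha] := ltnP a (size w); last first.
  rewrite big1 ?drop_oversize //= ?andbF // => i _.
  rewrite mxE; case: eqP => [hi|_]; last by rewrite mul0r.
  by have := ltn_ord i; rewrite hi; lia.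
have ha' : (a.+1 < (size w).+1)%N by [].
rewrite (bigD1 (Ordinal ha')) //= IH [X in _ + X]big1 ?addr0; last first.
  move=> i ni; rewrite mxE; case: eqP => [hi|_]; last by rewrite mul0r.
  by case/eqP: ni; apply: val_inj.
rewrite mxE eqxx /= addSnnS (drop_nth c ha) /= eqseq_cons.
by rewrite -natrM mulnb andbCA.
Qed.

(** Expand the product of the factors 1 + N_c; the set A records the positions
where N_c is chosen. *)
Lemma word_mx_subwords w u :
  word_mx w u = \sum_(A : {set 'I_(size u)}) \prod_(c <- subword u A) letter_mx w c.
Proof.
rewrite /word_mx (big_nth false) big_mkord.
under eq_bigr => i _ do rewrite addrC.
rewrite bigA_distr; apply: eq_bigr => A _.
by rewrite -big_mkcond /= /subword big_map -big_filter deprecated_filter_index_enum.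
Qed.

(** A product of k letter matrices reaches the corner entry (0, k) exactly when it
spells w. *)
Lemma count_subwords k n u w : size u = n -> size w = k ->
  word_mx w u ord0 ord_max =
    (count_mem w [seq subword u A | A <- enum [set A : {set 'I_n} | #|A| == k]])%:R.
Proof.
move=> <- <- {k n}; rewrite word_mx_subwords summxE.
under eq_bigr => A _ do rewrite prod_letters /= add0n drop0.
rewrite count_map -sum1_count big_enum_cond /= natr_sum.
rewrite [RHS]big_mkcond; apply: eq_bigr => A _ /=; rewrite inE.
rewrite /subword size_map -cardE eq_sym; case: eqP => //= ->.
by rewrite take_size eq_sym; case: eqP.
Qed.

Lemma perm_eq_subwords k n u v : size u = n -> size v = n ->
  agree_below k.+1 u v ->
  perm_eq [seq subword u A | A <- enum [set A : {set 'I_n} | #|A| == k]]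
          [seq subword v A | A <- enum [set A : {set 'I_n} | #|A| == k]].
Proof.
move=> su sv huv; apply/allP => w _ /=.
have [sw|sw] := eqVneq (size w) k; last first.
  have E t : count_mem w [seq subword t A | A <- enum [set A : {set 'I_n} | #|A| == k]] = 0%N.
    apply/count_memPn/mapP => -[A]; rewrite mem_enum inE => /eqP cA hw.
    by move: sw; rewrite hw size_map -cardE cA eqxx.
  by rewrite !E.
have /(huv w) : ((ord_max : 'I_(size w).+1) < (ord0 : 'I_(size w).+1) + k.+1)%N.
  by rewrite /= sw.
rewrite !mxE (count_subwords su sw) (count_subwords sv sw) => /eqP.
by rewrite subr_eq0 eqr_nat eq_sym.
Qed.

(** * From words to permutations *)

Lemma rank_perm n (f : 'I_n -> nat) : injective f ->
  exists x : 'S_n, forall i j, (x i <= x j)%N = (f i <= f j)%N.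
Proof.
move=> f_inj; pose below i := [set j | (f j < f i)%N].
have lt_below i : (#|below i| < n)%N.
  rewrite -[n in (_ < n)%N]card_ord -cardsT; apply: proper_card.
  by apply/properP; split; [apply: subsetT | exists i; rewrite !inE ?ltnn].
have mono i j : (#|below i| <= #|below j|)%N = (f i <= f j)%N.
  apply/idP/idP => [|hij].
    apply: contraTT; rewrite -!ltnNge => hji; apply: proper_card.
    apply/properP; split; last by exists j; rewrite !inE ?ltnn.
    by apply/subsetP => l; rewrite !inE => /ltn_trans ->.
  by apply/subset_leq_card/subsetP => l; rewrite !inE => /leq_trans ->.
have r_inj : injective (fun i => Ordinal (lt_below i)).
  move=> i j /(congr1 val) /= E; apply: f_inj.
  by apply/eqP; rewrite eqn_leq -!mono E leqnn.
by exists (perm r_inj) => i j; rewrite !permE /= mono.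
Qed.

(** Sorting positions by this key lists the zeros of u first, then the ones, each
from left to right. *)
Definition letter_key (n : nat) (u : seq bool) (i : nat) : nat :=
  (nth false u i * n + i)%N.

Lemma letter_key_le n u i j : (i < n)%N -> (j < n)%N ->
  (letter_key n u i <= letter_key n u j)%N =
  (if nth false u i == nth false u j then (i <= j)%N else nth false u j).
Proof. by rewrite /letter_key; case: nth; case: nth => /=; lia. Qed.

(** Renumbering only sees the relative order of the entries. *)
Lemma eq_renumber (T : eqType) (f g : T -> nat) (s : seq T) :
  {in s &, forall a b, (f a <= f b)%N = (g a <= g b)%N} ->
  renumber (map f s) = renumber (map g s).
Proof.
move=> fg; rewrite /renumber -!map_comp; apply/eq_in_map => a ha /=.
by rewrite !count_map; apply: eq_in_count => b hb /=; apply: fg.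
Qed.

Definition pattern (w : seq bool) : seq nat :=
  renumber [seq letter_key (size w) w i | i <- iota 0 (size w)].

(** Two positions in A compare by their letters and, for equal letters, by their
order in A; both can be read in the subword of u at A. *)
Lemma minor_pattern n (u : seq bool) (x : 'S_n) (A : {set 'I_n}) :
  (forall i j, (x i <= x j)%N = (letter_key n u i <= letter_key n u j)%N) ->
  minor x A = pattern (subword u A).
Proof.
move=> hx; rewrite /minor /pattern.
case: n u x A hx => [|n] u x A hx.
  rewrite /subword; case: (enum A) => [|[]] //.
set s := enum A; set k := size (subword u A).
have sk : size s = k by rewrite /k size_map.
have s_sorted : sorted ltn (map val s).
  have -> : s = [seq i <- enum 'I_n.+1 | i \in A] by rewrite /s {1}/enum_mem -enumT.
  rewrite sorted_map; apply: sorted_filter; first by move=> ? ? ?; apply: ltn_trans.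
  by rewrite -sorted_map val_enum_ord; apply: iota_ltn_sorted.
rewrite -[s in LHS](mkseq_nth ord0) sk /mkseq -map_comp; apply: eq_renumber => a b.
rewrite !mem_iota /= !add0n => ha hb.
rewrite hx !letter_key_le //.
rewrite /subword !(nth_map ord0) ?sk // -/s; case: eqP => // _.
have key c : val (nth ord0 s c) = nth 0%N (map val s) c.
  have [hc|hc] := ltnP c (size s); first by rewrite (nth_map ord0).
  by rewrite !nth_default ?size_map.
rewrite !key; apply/esym.
have homo := sorted_ltn_nth ltn_trans 0%N s_sorted.
by rewrite (leq_mono_in homo) // inE size_map sk.
Qed.

(** Pad both words with zeros up to length n. Equal subwords give equal decks. The
words can be recovered from the permutations, because the last letter is a zero:
a position carries the letter 1 exactly when its value exceeds the last one. *)
Lemma equal_decks k n u v :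
  size u = size v -> (size u < n)%N -> u <> v -> agree_below k.+1 u v ->
  ~ deck_reconstructible n k.
Proof.
move=> suv un nuv huv recon.
pose pad t := t ++ nseq (n - size u) false.
have n0 : (0 < n)%N by apply: leq_trans un.
have spad t : size t = size u -> size (pad t) = n.
  by move=> st; rewrite size_cat size_nseq st subnKC // ltnW.
have [su sv] := (spad u erefl, spad v (esym suv)).
have key_inj t : injective (fun i : 'I_n => letter_key n t i).
  move=> i j E; apply/eqP; rewrite -val_eqE /= eqn_leq.
  have := letter_key_le t (ltn_ord i) (ltn_ord j).
  have := letter_key_le t (ltn_ord j) (ltn_ord i).
  by rewrite E leqnn [nth _ _ j == _]eq_sym; case: eqP => [_ <- <-|] //; do 2![case: nth => //].
have [x hx] := rank_perm (key_inj (pad u)).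
have [y hy] := rank_perm (key_inj (pad v)).
apply: (recon x y); last first.
  apply/eq_seq_msetP.
  have deckE t (z : 'S_n) s : (forall i j : 'I_n,
      (z i <= z j)%N = (letter_key n t i <= letter_key n t j)%N) ->
      [seq minor z A | A <- s] = [seq pattern w | w <- [seq subword t A | A <- s]].
    by move=> hz; rewrite -map_comp; apply: eq_map => A; apply: minor_pattern.
  rewrite (deckE _ _ _ hx) (deckE _ _ _ hy).
  apply: perm_map; apply: perm_eq_subwords => //.
  exact: agree_cat.
move=> xy; apply: nuv.
have ln : (n.-1 < n)%N by rewrite prednK.
pose l : 'I_n := Ordinal ln.
have last_letter t : size t = size u -> nth false (pad t) l = false.
  by move=> st; rewrite nth_cat st /= ltnNge -ltnS prednK // un /= nth_nseq if_same.
have letter t (z : 'S_n) (i : 'I_n) : size t = size u ->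
  (forall i j : 'I_n, (z i <= z j)%N = (letter_key n (pad t) i <= letter_key n (pad t) j)%N) ->
  nth false (pad t) i = ~~ (z i <= z l)%N.
  move=> st hz; rewrite hz letter_key_le // last_letter //.
  case: nth => //=; rewrite -ltnS prednK //; exact/esym/negbTE/negPn/ltn_ord.
have /eqP : pad u = pad v.
  apply: (@eq_from_nth _ false); first by rewrite su sv.
  rewrite su => i hi.
  by rewrite -[i]/(val (Ordinal hi)) (letter u x) // (letter v y) // xy.
by rewrite eqseq_cat // => /andP[/eqP].
Qed.

(** * Choice of the parameters *)

(** Since ln 2 <= 1, the square root is at most 2(t+2), and (t+2)/4 <= t-1 for
t >= 2, so the left side is at most 2^(t-1). *)
Lemma exp_sqrt_ln_le (R : realType) (d t : nat) : (2 <= t)%N -> (0 < d)%N ->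
  (d <= 2 ^ (2 * t.+1 * t.+2))%N ->
  expR (ln 2 / 8 * Num.sqrt (ln (d%:R : R))) <= (2 ^ t - 1)%:R.
Proof.
move=> t2 d0 hd.
have ln2_gt0 : 0 < ln (2 : R) by rewrite ln_gt0 // ltr1n.
have ln2_le1 : ln (2 : R) <= 1.
  by have := @le_ln1Dx R 1; rewrite -[1 + 1]/2; apply; lra.
have ln2X e : ln ((2 ^ e)%:R : R) = e%:R * ln 2.
  by rewrite natrX lnXn // mulr_natl.
have sqrt_le : Num.sqrt (ln (d%:R : R)) <= 2 * t.+2%:R.
  have p0 : 0 <= 2 * t.+2%:R :> R by rewrite mulr_ge0.
  rewrite -[leRHS](ger0_norm p0) -sqrtr_sqr.
  apply: ler_wsqrtr.
  have hln : ln (d%:R : R) <= (2 * t.+1 * t.+2)%:R * ln 2.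
    by rewrite -ln2X ler_ln ?posrE ?ltr0n ?expn_gt0 // ler_nat.
  apply: (le_trans hln); apply: (@le_trans _ _ (2 * t.+1 * t.+2)%:R).
    by rewrite ler_piMr.
  by rewrite -natrM -natrX ler_nat; lia.
apply: (@le_trans _ _ ((2 ^ t.-1)%:R)); last first.
  rewrite ler_nat; have := expn_gt0 2 t.-1; rewrite /=.
  have -> : (2 ^ t = 2 * 2 ^ t.-1)%N by rewrite -expnS prednK // ltnW.
  lia.
rewrite -[leRHS]lnK ?posrE ?ltr0n ?expn_gt0 // ler_expR ln2X.
apply: (le_trans (ler_wpM2l _ sqrt_le)); first by rewrite divr_ge0 // ltW.
rewrite -mulrA [leRHS]mulrC; apply: ler_wpM2l; first exact: ltW.
have : t.+2%:R <= 4 * t.-1%:R :> R by rewrite -natrM ler_nat; lia.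
lra.
Qed.

Lemma tower_level (d : nat) : (2 ^ 12 <= d)%N ->
  exists2 t, (2 <= t)%N & (2 ^ (2 * t * t.+1) <= d < 2 ^ (2 * t.+1 * t.+2))%N.
Proof.
move=> hd; pose P t := (2 ^ (2 * t * t.+1) <= d)%N.
have exP : exists t, P t by exists 2%N.
have bP t : P t -> (t <= d)%N.
  move=> /(leq_trans _); apply; apply: (leq_trans (ltnW (ltn_expl t (ltnSn 1)))).
  by rewrite leq_exp2l //; nia.
case: (ex_maxnP exP bP) => t Pt tmax; exists t; first by apply: tmax.
apply/andP; split; first exact: Pt.
by rewrite ltnNge; apply/negP => /tmax; rewrite ltnn.
Qed.

Theorem mainTheorem4 (R : realType) :
  exists (c : R) (d0 : nat), 0 < c /\
    forall d : nat, (0 < d)%N -> (d0 <= d)%N ->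
      forall N : nat, is_N d N ->
        N%:R > d%:R + expR (c * Num.sqrt (ln (d%:R : R))).
Proof.
exists (ln 2 / 8), (2 ^ 12)%N; split; first by rewrite divr_gt0 // ln_gt0 // ltr1n.
move=> d d_gt0 /tower_level[t t2 /andP[le_d lt_d]] N [[_ recN] _].
rewrite ltNge; apply/negP => leN.
set k := (2 ^ t - 1)%N.
have kE : k.+1 = (2 ^ t)%N by rewrite /k subn1 prednK // expn_gt0.
have hN : (N <= d + k)%N.
  rewrite -(ler_nat R) natrD; apply: (le_trans leN); rewrite lerD2l.
  by apply: exp_sqrt_ln_le => //; apply: ltnW.
have [u [v [su sv nuv huv]]] := agreeing_words t.
have := recN _ hN; rewrite addKn.
apply: (equal_decks _ _ nuv); rewrite ?kE ?su ?sv //.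
have k0 : (0 < k)%N by rewrite -ltnS kE -[1%N]/(2 ^ 0)%N ltn_exp2l // ltnW.
by apply: (leq_ltn_trans le_d); rewrite -[d in (d < _)%N]addn0 ltn_add2l.
Qed.
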